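(* There exists a context-free language $L$ such that there is no algorithm which decides, given a regular language $R$, whether $R$ is contained in $L$.
   Context: Regular languages $R$ are given as input encoded as finite automata over the alphabet of $L$; the language $L$ is fixed. *)

(* Defs.v *)
From mathcomp Require Import all_boot.
From Stdlib Require Import Relations.

Set Implicit Arguments.
Unset Strict Implicit.
Unset Printing Implicit Defensive.

Definition language (Sigma : Type) := seq Sigma -> Prop.

Definition included (Sigma : Type) (K L : language Sigma) : Prop :=
  forall w, K w -> L w.

Record cfg (Sigma : finType) := Cfg {
  nonterminal : finType;
  start : nonterminal;
  rules : seq (nonterminal * seq (nonterminal + Sigma))
}.

Inductive derives1 (Sigma : finType) (G : cfg Sigma) :
  relation (seq (nonterminal G + Sigma)) :=
| Derives1 u v X rhs :
    (X, rhs) \in rules G ->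
    derives1 (u ++ inl X :: v) (u ++ rhs ++ v).

Definition derives (Sigma : finType) (G : cfg Sigma) :
  relation (seq (nonterminal G + Sigma)) :=
  clos_refl_trans _ (@derives1 Sigma G).

Definition cfg_language (Sigma : finType) (G : cfg Sigma) : language Sigma :=
  fun w => derives [:: inl (start G)] [seq inr a | a <- w].

Definition context_free (Sigma : finType) (L : language Sigma) : Prop :=
  exists G : cfg Sigma, forall w, L w <-> cfg_language G w.

(* Nondeterministic automata. States are named by natural numbers, so that an
   automaton is a finite object that can be given as an input; its (finite)
   set of states consists of the numbers occurring in the three lists. *)
Record automaton (Sigma : finType) := Automaton {
  initial : seq nat;
  final : seq nat;
  transitions : seq (nat * Sigma * nat)
}.

Fixpoint run (Sigma : finType) (A : automaton Sigma)
    (p : nat) (w : seq Sigma) (q : nat) : Prop :=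
  if w is a :: w' then
    exists2 r, (p, a, r) \in transitions A & run A r w' q
  else p = q.

Definition automaton_language (Sigma : finType) (A : automaton Sigma) :
  language Sigma :=
  fun w => exists p q, [/\ p \in initial A, q \in final A & run A p w q].

(* [CodeSeq.code] is the usual computable bijection from [seq nat] to [nat]:
   [::] |-> 0 and n :: s |-> 2 ^ n * (2 * code s + 1). Letters are numbered by
   their rank in the enumeration of the alphabet. *)
Definition encode_transition (Sigma : finType) (t : nat * Sigma * nat) : nat :=
  CodeSeq.code [:: t.1.1; nat_of_ord (enum_rank t.1.2); t.2].

Definition encode_automaton (Sigma : finType) (A : automaton Sigma) : nat :=
  CodeSeq.code
    [:: CodeSeq.code (initial A);
        CodeSeq.code (final A);
        CodeSeq.code [seq encode_transition t | t <- transitions A]].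

Lemma encode_transition_inj (Sigma : finType) :
  injective (@encode_transition Sigma).
Proof.
move=> [[p a] q] [[p' a'] q'] /(can_inj CodeSeq.codeK) [] /= -> e ->.
by rewrite (enum_rank_inj (val_inj e)).
Qed.

Lemma encode_automaton_inj (Sigma : finType) :
  injective (@encode_automaton Sigma).
Proof.
have inj := can_inj CodeSeq.codeK.
move=> [i f t] [i' f' t'] /inj [] /= /inj -> /inj -> /inj.
by move/(inj_map (@encode_transition_inj Sigma)) ->.
Qed.

Inductive recfun : nat -> Type :=
| Zero n : recfun n
| Succ : recfun 1
| Proj n : 'I_n -> recfun n
| Comp k n : recfun k -> ('I_k -> recfun n) -> recfun n
| PrimRec n : recfun n -> recfun n.+2 -> recfun n.+1
| Mu n : recfun n.+1 -> recfun n.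

(* [eval f xs y]: the computation of [f] on [xs] halts with result [y].
   In [Mu] the function has to be defined (and nonzero) on every number
   below the result. *)
Fixpoint eval (n : nat) (f : recfun n) : n.-tuple nat -> nat -> Prop :=
  match f in recfun n return n.-tuple nat -> nat -> Prop with
  | Zero _ => fun _ y => y = 0
  | Succ => fun xs y => y = (thead xs).+1
  | Proj _ i => fun xs y => y = tnth xs i
  | Comp k _ g h => fun xs y =>
      exists2 ys : k.-tuple nat,
        forall i, eval (h i) xs (tnth ys i) & eval g ys y
  | PrimRec _ g h => fun xs y =>
      let params := behead_tuple xs in
      (fix iter (m z : nat) : Prop :=
         if m is m'.+1 then
           exists2 z', iter m' z' & eval h [tuple of m' :: z' :: params] z
         else eval g params z) (thead xs) y
  | Mu _ g => fun xs y =>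
      eval g [tuple of y :: xs] 0 /\
      forall z, z < y -> exists v, eval g [tuple of z :: xs] v.+1
  end.

(* Algorithms are unary partial recursive functions, answering 1 for yes and 0
   for no; no requirement is made on numbers that do not encode an instance. *)
Definition decidable_problem (T : Type) (encode : T -> nat) (P : T -> Prop) :
  Prop :=
  exists f : recfun 1, forall x : T,
    (P x -> eval f [tuple encode x] 1) /\
    (~ P x -> eval f [tuple encode x] 0).

(* Main.v *)
Require Import Defs.
From mathcomp Require Import all_boot.
From Stdlib Require Import Relations.

(* A nondeterministic finite automaton whose letters are pushes and pops on three
   stacks is a program. Its accepted words are the traces of the program that
   ignore the contents of the stacks, and a trace is infeasible iff it is
   infeasible for one of the stacks, which is a context-free condition: some pop
   hits the empty stack, or does not match the symbol pushed before a balanced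
   word. Let L be the set of infeasible traces. Then R is contained in L iff the
   program R has no halting computation. Since three stacks suffice to compute
   every partial recursive function f, Kleene's recursion theorem yields a
   program which halts iff f answers 1 on the code of that very program, so f
   does not decide inclusion in L. *)

Set Implicit Arguments.
Unset Strict Implicit.
Unset Printing Implicit Defensive.

(** * Infeasible traces form a context-free language *)

(** Inclusion only asks whether some accepted trace is feasible, so programs may guess: a [Star] can
    be left at any time, and a later pop kills the runs that left at a wrong one. This gives loops
    and tests without a branching construct. As guessing must neither lose nor add results, a
    program is specified by the exact set of its halting configurations. The recursion theorem needs
    neither an interpreter nor a decoding of programs. The automaton that loads [n] before running
    [T] has a transition list ending in [T], and the code of a list is built up from the code of its
    tail. When [n] is the code of [T], the code of the whole is therefore an explicit primitive
    recursive function of [n]. *)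

Fixpoint yields (Sigma N : Type) (I : N -> language Sigma)
    (s : seq (N + Sigma)) : language Sigma :=
  fun w => match s with
  | [::] => w = [::]
  | inr a :: s' => exists2 v, w = a :: v & yields I s' v
  | inl X :: s' => exists u v, [/\ w = u ++ v, I X u & yields I s' v]
  end.

Lemma yields_cat (Sigma N : Type) (I : N -> language Sigma) s t w :
  yields I (s ++ t) w <->
  exists u v, [/\ w = u ++ v, yields I s u & yields I t v].
Proof.
elim: s w => [|[X|a] s IH] w /=.
- split=> [tw|[u [v [-> -> //]]]].
  by exists [::], w.
- split=> [[u [v [-> Iu /IH [v1 [v2 [-> s1 t2]]]]]]|].
    by exists (u ++ v1), v2; rewrite catA; split=> //; exists u, v1.
  case=> _ [v [-> [u1 [u2 [-> Iu s2]]] tv]].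
  exists u1, (u2 ++ v); rewrite catA; split=> //.
  by apply/IH; exists u2, v.
- split=> [[v -> /IH [v1 [v2 [-> s1 t2]]]]|].
    by exists (a :: v1), v2; split=> //; exists v1.
  case=> _ [v [-> [u -> su] tv]].
  by exists (u ++ v) => //; apply/IH; exists u, v.
Qed.

Lemma yields_letters (Sigma N : Type) (I : N -> language Sigma) w :
  yields I [seq inr a | a <- w] w.
Proof. by elim: w => //= a w IH; exists w. Qed.

(** The generated languages form the least family closed under the rules. Going back from the
    terminal word, each rewriting step is undone by closure under its rule. *)
Lemma derives_yields (Sigma : finType) (G : cfg Sigma)
    (I : nonterminal G -> language Sigma) :
  (forall X rhs w, (X, rhs) \in rules G -> yields I rhs w -> I X w) ->
  forall s w, derives s [seq inr a | a <- w] -> yields I s w.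
Proof.
move=> stable s w sw; have := yields_letters I w.
elim: sw => // {s} [_ _ [u v X rhs rX]|s t r _ IHs _ IHt /IHt/IHs //].
case/yields_cat=> u1 [v1 [-> Iu /yields_cat[v2 [v3 [-> Irhs Iv]]]]].
apply/yields_cat; exists u1, (v2 ++ v3); split=> //=.
by exists v2, v3; split=> //; apply: stable Irhs.
Qed.

Lemma derives_context (Sigma : finType) (G : cfg Sigma) u v
    (s t : seq (nonterminal G + Sigma)) :
  derives s t -> derives (u ++ s ++ v) (u ++ t ++ v).
Proof.
elim=> {s t} [_ _ [x y X rhs rX]|s|s t r _ IH1 _ IH2].
- rewrite -!catA /= !(catA u); apply: rt_step; exact: Derives1.
- exact: rt_refl.
- exact: rt_trans IH1 IH2.
Qed.

Lemma yields_derives (Sigma : finType) (G : cfg Sigma)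
    (s : seq (nonterminal G + Sigma)) w :
  yields (fun X u => @derives _ G [:: inl X] [seq inr a | a <- u]) s w ->
  derives s [seq inr a | a <- w].
Proof.
elim: s w => [|[X|a] s IH] w /=; first by move=> ->; apply: rt_refl.
- case=> u [v [-> Xu /IH sv]]; rewrite map_cat.
  apply: (rt_trans _ _ _ ([seq inr a | a <- u] ++ s)).
    exact: (derives_context [::] s Xu).
  by have := derives_context [seq inr a | a <- u] [::] sv; rewrite !cats0.
- case=> v -> /IH sv.
  by have := derives_context [:: inr a] [::] sv; rewrite !cats0.
Qed.

(** Membership can thus be shown by cutting a word along a right-hand side, without writing out a
    derivation. *)
Lemma rule_derives (Sigma : finType) (G : cfg Sigma) X rhs w :
  (X, rhs) \in rules G ->
  yields (fun Y u => @derives _ G [:: inl Y] [seq inr a | a <- u]) rhs w ->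
  @derives _ G [:: inl X] [seq inr a | a <- w].
Proof.
move=> rX /yields_derives rw; apply: rt_trans rw.
by have := Derives1 [::] [::] rX; rewrite /= cats0; apply: rt_step.
Qed.

(** * Traces on three stacks and their grammar *)

Definition stack_id : finType := option bool.

(* [None] does nothing; [Some (i, true, b)] pushes [b] on stack [i] and
   [Some (i, false, b)] pops [b] from it. *)
Definition letter : finType := option (stack_id * bool * bool).

Definition push (i : stack_id) (b : bool) : letter := Some (i, true, b).
Definition pop (i : stack_id) (b : bool) : letter := Some (i, false, b).

Definition act1 (i : stack_id) (a : letter) (s : seq bool) :
    option (seq bool) :=
  if a is Some (j, pushing, b) then
    if j == i then
      if pushing then Some (b :: s)
      else if s is b' :: s' then if b == b' then Some s' else None else None
    else Some s
  else Some s.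

Fixpoint exec1 (i : stack_id) (w : seq letter) (s : seq bool) :
    option (seq bool) :=
  if w is a :: w' then obind (exec1 i w') (act1 i a s) else Some s.

Lemma exec1_cat i u v s : exec1 i (u ++ v) s = obind (exec1 i v) (exec1 i u s).
Proof. by elim: u s => //= a u IH s; case: act1 => //= s'. Qed.

Definition touches (i : stack_id) (a : letter) : bool :=
  if a is Some (j, _, _) then j == i else false.

Definition trace_nt : finType := option (option stack_id).
Definition invalid : trace_nt := None.
Definition anything : trace_nt := Some None.
Definition balanced (i : stack_id) : trace_nt := Some (Some i).

(* A trace is invalid for stack [i] iff some letter pops from the empty stack
   or pops another symbol than the one last pushed; what lies between is
   balanced. *)
Definition trace_rules : seq (trace_nt * seq (trace_nt + letter)) :=
  [seq (invalid, [:: inl (balanced i); inr (pop i b); inl anything])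
     | i <- enum stack_id, b <- enum {: bool}]
  ++ [seq (invalid, [:: inl anything; inr (push i b); inl (balanced i);
                        inr (pop i (~~ b)); inl anything])
     | i <- enum stack_id, b <- enum {: bool}]
  ++ (anything, [::]) :: [seq (anything, [:: inr a; inl anything])
     | a <- enum letter]
  ++ [seq (balanced i, [::]) | i <- enum stack_id]
  ++ [seq (balanced i, [:: inl (balanced i); inr a])
     | i <- enum stack_id, a <- [seq a <- enum letter | ~~ touches i a]]
  ++ [seq (balanced i, [:: inl (balanced i); inr (push i b);
                           inl (balanced i); inr (pop i b)])
     | i <- enum stack_id, b <- enum {: bool}].

Definition trace_cfg : cfg letter := Cfg invalid trace_rules.

(** The list of rules as a relation, for case analysis. The rules for [balanced] extend a word at
    its right end, which suits a trace read from left to right. *)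
Inductive trace_rule : trace_nt -> seq (trace_nt + letter) -> Prop :=
| Underflow i b :
    trace_rule invalid [:: inl (balanced i); inr (pop i b); inl anything]
| Mismatch i b :
    trace_rule invalid [:: inl anything; inr (push i b); inl (balanced i);
                           inr (pop i (~~ b)); inl anything]
| AnyNil : trace_rule anything [::]
| AnyCons a : trace_rule anything [:: inr a; inl anything]
| BalNil i : trace_rule (balanced i) [::]
| BalOther i a : ~~ touches i a ->
    trace_rule (balanced i) [:: inl (balanced i); inr a]
| BalPair i b :
    trace_rule (balanced i) [:: inl (balanced i); inr (push i b);
                                inl (balanced i); inr (pop i b)].

Lemma trace_rulesP X rhs : (X, rhs) \in trace_rules <-> trace_rule X rhs.
Proof.
split.
  rewrite !(mem_cat, in_cons).
  case/or4P; try by [case/allpairsPdep=> i [b [_ _ [-> ->]]]; constructor].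
    by case/eqP=> -> ->; constructor.
  case/or4P.
  - by case/mapP=> a _ [-> ->]; constructor.
  - by case/mapP=> i _ [-> ->]; constructor.
  - case/allpairsPdep=> i [a [_]]; rewrite mem_filter => /andP[ia _] [-> ->].
    by constructor.
  - by case/allpairsPdep=> i [b [_ _ [-> ->]]]; constructor.
case=> [i b|i b||a|i|i a ia|i b]; rewrite !(mem_cat, in_cons).
- by rewrite allpairs_f ?mem_enum.
- by apply/orP; right; rewrite (allpairs_f (fun i b => (invalid, _))) ?mem_enum.
- by rewrite eqxx !orbT.
- by rewrite (map_f (fun a => (anything, _))) ?mem_enum ?orbT.
- by rewrite (map_f (fun i => (balanced i, _))) ?mem_enum ?orbT.
- apply/orP; right; apply/orP; right; apply/orP; right.
  apply/orP; right; apply/orP; right; apply/orP; left.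
  apply/allpairsPdep; exists i, a; rewrite mem_enum mem_filter.
  by split=> //; rewrite ia mem_enum.
- do 6! [apply/orP; right].
  by rewrite (allpairs_f (fun i b => (balanced i, _))) ?mem_enum.
Qed.

Definition generates (X : trace_nt) (w : seq letter) : Prop :=
  @derives _ trace_cfg [:: inl X] [seq inr a | a <- w].

Lemma generates_rule X rhs w :
  trace_rule X rhs -> yields generates rhs w -> generates X w.
Proof. by move/trace_rulesP=> rX; apply: (@rule_derives _ trace_cfg). Qed.

(** For [balanced i], ranging over all [s], the empty one included, says that the word restores the
    stack and never reads what lay below. *)
Definition trace_sem (X : trace_nt) : language letter :=
  match X with
  | None => fun w => exists i, exec1 i w [::] = None
  | Some None => fun _ => True
  | Some (Some i) => fun w => forall s, exec1 i w s = Some s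
  end.

Lemma trace_sem_closed X rhs w :
  trace_rule X rhs -> yields trace_sem rhs w -> trace_sem X w.
Proof.
case=> {X rhs} [i b|i b||a|i|i a ia|i b] //=.
- case=> u [_ [-> Bu [_ -> [v [_ [-> _ ->]]]]]].
  by exists i; rewrite exec1_cat Bu /= eqxx.
- case=> t [_ [-> _ [_ -> [u [_ [-> Bu [_ -> [v [_ [-> _ ->]]]]]]]]]].
  (* If the arbitrary prefix already fails, so does the whole word. *)
  exists i; rewrite exec1_cat; case: exec1 => //= s.
  by rewrite eqxx /= exec1_cat Bu /= eqxx; case: b.
- by move=> -> s.
- case=> u [_ [-> Bu [_ -> ->]]] s; rewrite exec1_cat Bu /=.
  by case: a ia => [[[j p] b]|] //= /negPf ->.
- case=> u [_ [-> Bu [_ -> [v [_ [-> Bv [_ -> ->]]]]]]] s.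
  by rewrite exec1_cat Bu /= eqxx /= exec1_cat Bv /= !eqxx.
Qed.

Lemma generates_anything w : generates anything w.
Proof.
elim: w => [|a w IH]; first exact: (generates_rule AnyNil).
apply: (generates_rule (AnyCons a)); exists w => //=.
by exists w, [::]; rewrite cats0.
Qed.

(** The invariant behind completeness of the grammar: the symbols of [s] come from the pushes in [u]
    that are still open, and [u] is balanced before, between and after these. *)
Fixpoint parses (i : stack_id) (s : seq bool) (u : seq letter) : Prop :=
  if s is b :: s' then
    exists u1 u2, [/\ u = u1 ++ push i b :: u2, parses i s' u1
                    & generates (balanced i) u2]
  else generates (balanced i) u.

Lemma parses_balanced i s u v :
  (forall x, generates (balanced i) x -> generates (balanced i) (x ++ v)) ->
  parses i s u -> parses i s (u ++ v).
Proof.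
move=> stable; case: s => [|b s] /=; first exact: stable.
case=> u1 [u2 [-> pu1 /stable Bu2]].
by exists u1, (u2 ++ v); rewrite -catA.
Qed.

Lemma parses_act i s u a s' :
  parses i s u -> act1 i a s = Some s' -> parses i s' (rcons u a).
Proof.
case: (boolP (touches i a)) => ia pu; last first.
  have -> : act1 i a s = Some s by case: a ia => [[[j p] b]|] //= /negPf ->.
  case=> <-; rewrite -cats1; apply: parses_balanced pu => x Bx.
  apply: (generates_rule (BalOther ia)); exists x, [:: a]; split=> //.
  by exists [::].
case: a ia => [[[j p] b]|] //= /eqP ->; rewrite eqxx; case: p => [[<-]|].
  exists u, [::]; rewrite -cats1; split=> //.
  exact: (generates_rule (BalNil i)).
case: s pu => [|b' s] //= [u1 [u2 [-> pu1 Bu2]]]; case: eqP => // <- [<-].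
rewrite -cats1 -catA; apply: parses_balanced pu1 => x Bx.
apply: (generates_rule (BalPair i b)).
exists x, (push i b :: u2 ++ [:: pop i b]).
split=> //; exists (u2 ++ [:: pop i b]) => //.
by exists u2, [:: pop i b]; split=> //; exists [::].
Qed.

(** The first letter that fails is a pop, and the invariant tells which rule applies: [Underflow] if
    no push is open, [Mismatch] if the last open push has the other symbol. *)
Lemma parses_exec i s u w :
  parses i s u -> exec1 i w s = None -> generates invalid (u ++ w).
Proof.
elim: w s u => [|a w IH] //= s u pu.
case E: (act1 i a s) => [s'|] /=.
  by rewrite -cat_rcons; apply: IH; apply: parses_act E.
move=> _; case: a E => [[[j p] b]|] //=; case: eqP => // ->; case: p => //.
case: s pu => [|b' s] /= pu.
  move=> _; apply: (generates_rule (Underflow i b)).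
  exists u, (pop i b :: w); split=> //; exists w => //.
  by exists w, [::]; rewrite cats0; split=> //; apply: generates_anything.
case: pu => u1 [u2 [-> _ Bu2]]; case: eqP => // bb' _.
have -> : b = ~~ b' by case: b b' bb' => [] [].
apply: (generates_rule (Mismatch i b')).
exists u1, (push i b' :: u2 ++ pop i (~~ b') :: w); rewrite -catA.
split=> //; first exact: generates_anything.
exists (u2 ++ pop i (~~ b') :: w) => //.
exists u2, (pop i (~~ b') :: w); split=> //; exists w => //.
by exists w, [::]; rewrite cats0; split=> //; apply: generates_anything.
Qed.

Lemma trace_cfgP w :
  cfg_language trace_cfg w <-> exists i, exec1 i w [::] = None.
Proof.
split=> [|[i wi]]; last first.
  apply: (@parses_exec i [::] [::]) => //.
  exact: (generates_rule (BalNil i)).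
move/(@derives_yields _ trace_cfg trace_sem); case.
  by move=> X rhs v /trace_rulesP; apply: trace_sem_closed.
by move=> u [v [-> Su ->]]; rewrite cats0.
Qed.

(** * Recursive functions *)

(** The recursion inside [eval] under a name, with base and step as parameters, so that the base can
    later be replaced by a fixed value. *)
Definition prim_iter (n : nat) (g : n.-tuple nat -> nat -> Prop)
    (h : n.+2.-tuple nat -> nat -> Prop) (xs : n.-tuple nat) :
    nat -> nat -> Prop :=
  fix iter (m z : nat) : Prop :=
    if m is m'.+1 then
      exists2 z', iter m' z' & h [tuple of m' :: z' :: xs] z
    else g xs z.

Lemma eval_PrimRec n (g : recfun n) (h : recfun n.+2) (xs : n.+1.-tuple nat) y :
  eval (PrimRec g h) xs y =
  prim_iter (eval g) (eval h) (behead_tuple xs) (thead xs) y.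
Proof. by []. Qed.

Lemma eval_functional n (f : recfun n) xs y y' :
  eval f xs y -> eval f xs y' -> y = y'.
Proof.
elim: f xs y y' => {n} [n|||k n g IHg h IHh|n g IHg h IHh|n g IHg] xs y y' /=.
- by move=> -> ->.
- by move=> -> ->.
- by move=> n i -> ->.
- case=> ys hys gy [ys' hys' gy']; apply: (IHg ys) => //.
  suff -> : ys = ys' by [].
  by apply: eq_from_tnth => i; apply: IHh (hys i) (hys' i).
- rewrite -!/(eval (PrimRec g h) xs _) !eval_PrimRec.
  elim: (thead xs) y y' => [|m IH] y y' /=; first exact: IHg.
  case=> z pz hz [z' pz' hz']; have zz' := IH _ _ pz pz'; subst z'.
  exact: IHh hz hz'.
- case=> gy ly [gy' ly']; case: (ltngtP y y') => // lt_yy'.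
  + by have [v /(IHg _ _ _ gy)] := ly' _ lt_yy'.
  + by have [v /(IHg _ _ _ gy')] := ly _ lt_yy'.
Qed.

Definition computable (n : nat) (F : n.-tuple nat -> nat) : Prop :=
  exists f : recfun n, forall xs, eval f xs (F xs).

Lemma computable_comp k n (G : k.-tuple nat -> nat)
    (H : 'I_k -> n.-tuple nat -> nat) :
  computable G -> (forall i, computable (H i)) ->
  computable (fun xs => G [tuple H i xs | i < k]).
Proof.
case=> g gG cH.
have [h hH] : exists h : 'I_k -> recfun n, forall i xs, eval (h i) xs (H i xs).
  exact: (fin_all_exists (P := fun i h => forall xs, eval h xs (H i xs))).
exists (Comp g h) => xs /=; exists [tuple H i xs | i < k] => // i.
by rewrite tnth_mktuple.
Qed.

Lemma computable_proj n (i : 'I_n) : computable (fun xs => tnth xs i).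
Proof. by exists (Proj i). Qed.

Lemma computable_comp1 n (op : nat -> nat) (F : n.-tuple nat -> nat) :
  computable (fun xs : 1.-tuple nat => op (thead xs)) -> computable F ->
  computable (fun xs => op (F xs)).
Proof.
move=> c cF; have [f fP] := computable_comp c (fun _ : 'I_1 => cF).
by exists f => xs; have := fP xs; rewrite /thead tnth_mktuple.
Qed.

Lemma computable_comp2 n (op : nat -> nat -> nat) (F G : n.-tuple nat -> nat) :
  computable (fun xs : 2.-tuple nat => op (thead xs) (tnth xs ord_max)) ->
  computable F -> computable G -> computable (fun xs => op (F xs) (G xs)).
Proof.
move=> c cF cG.
have [f fP] := computable_comp c
  (H := fun i : 'I_2 => if i == ord0 then F else G)
  (fun i => if i == ord0 as b return computable (if b then F else G)
            then cF else cG).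
by exists f => xs; have := fP xs; rewrite /thead !tnth_mktuple.
Qed.

Lemma computable_succ n (F : n.-tuple nat -> nat) :
  computable F -> computable (fun xs => (F xs).+1).
Proof. by apply: computable_comp1; exists Succ. Qed.

Lemma computable_const n c : computable (fun _ : n.-tuple nat => c).
Proof. by elim: c => [|c /computable_succ //]; exists (Zero n). Qed.

Lemma computable_rec n (G : n.-tuple nat -> nat) (H : n.+2.-tuple nat -> nat)
    (F : nat -> n.-tuple nat -> nat) :
  computable G -> computable H ->
  (forall xs, F 0 xs = G xs) ->
  (forall m xs, F m.+1 xs = H [tuple of m :: F m xs :: xs]) ->
  computable (fun xs : n.+1.-tuple nat => F (thead xs) (behead_tuple xs)).
Proof.
move=> [g gG] [h hH] F0 FS; exists (PrimRec g h) => xs.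
rewrite eval_PrimRec; elim: (thead xs) => [|m IH] /=; first by rewrite F0.
by exists (F m (behead_tuple xs)) => //; rewrite FS.
Qed.

Lemma computable_binary_rec (F : nat -> nat -> nat) (G : nat -> nat)
    (H : nat -> nat -> nat -> nat) :
  computable (fun xs : 1.-tuple nat => G (thead xs)) ->
  computable (fun xs : 3.-tuple nat =>
    H (thead xs) (tnth xs (inord 1)) (tnth xs ord_max)) ->
  (forall x, F 0 x = G x) ->
  (forall m x, F m.+1 x = H m (F m x) x) ->
  computable (fun xs : 2.-tuple nat => F (thead xs) (tnth xs ord_max)).
Proof.
move=> cG cH F0 FS.
have [|m xs|f fP] := computable_rec (F := fun m xs => F m (thead xs)) cG cH.
- by move=> xs; rewrite F0.
- rewrite FS; congr H.
  + by rewrite (tnth_nth 0) /= inordK.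
  + by rewrite /thead !(tnth_nth 0).
exists f => xs; suff -> : tnth xs ord_max = thead (behead_tuple xs) by [].
by rewrite /thead !(tnth_nth 0) /= nth_behead.
Qed.

Lemma computable_add n (F G : n.-tuple nat -> nat) :
  computable F -> computable G -> computable (fun xs => F xs + G xs).
Proof.
apply: computable_comp2.
apply: (@computable_binary_rec addn id (fun _ z _ => z.+1)) => //.
- exact: computable_proj.
- exact/computable_succ/computable_proj.
Qed.

Definition code_cons (x z : nat) : nat := 2 ^ x * z.*2.+1.

Lemma code_consE x s : CodeSeq.code (x :: s) = code_cons x (CodeSeq.code s).
Proof. by []. Qed.

(** Recursion on the head: [code_cons 0 z] is [2z + 1], and each increment of the head doubles the
    value, so addition suffices. *)
Lemma computable_cons n (F G : n.-tuple nat -> nat) :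
  computable F -> computable G ->
  computable (fun xs => code_cons (F xs) (G xs)).
Proof.
apply: computable_comp2.
apply: (@computable_binary_rec code_cons (fun z => (z + z).+1)
  (fun _ z _ => z + z)) => [|||m x].
- by apply/computable_succ/computable_add; apply: computable_proj.
- by apply: computable_add; apply: computable_proj.
- by move=> x; rewrite /code_cons mul1n addnn.
- by rewrite /code_cons expnS -mulnA mul2n addnn.
Qed.

(** * Stack programs *)

Definition i0 : stack_id := None.
Definition i1 : stack_id := Some true.
Definition i2 : stack_id := Some false.

Definition config : Type := (seq bool * seq bool * seq bool)%type.

Definition act (a : letter) (c : config) : option config :=
  let: (s0, s1, s2) := c in
  match act1 i0 a s0, act1 i1 a s1, act1 i2 a s2 with
  | Some t0, Some t1, Some t2 => Some (t0, t1, t2)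
  | _, _, _ => None
  end.

(** Regular expressions without union: choice comes from [Star] alone, conditions from pops that
    fail. *)
Inductive prog :=
| Op of letter
| Seq of prog & prog
| Star of prog.

Fixpoint sem (P : prog) : relation config :=
  match P with
  | Op a => fun c d => act a c = Some d
  | Seq P Q => fun c d => exists2 e, sem P c e & sem Q e d
  | Star P => clos_refl_trans_1n _ (sem P)
  end.

(* A number is stored as a block of [true]s above a [false]. *)
Definition state : Type := (seq nat * seq nat * seq nat)%type.

Definition blocks (l : seq nat) : seq bool :=
  foldr (fun x s => nseq x true ++ false :: s) [::] l.

Definition stacks (st : state) : config :=
  let: (l, m, n) := st in (blocks l, blocks m, blocks n).

(** The equivalence also ensures that every halting configuration is again made of blocks. Failure
    and divergence are both expressed by an empty [Q]. *)
Definition spec (P : prog) (st : state) (Q : state -> Prop) : Prop :=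
  forall c, sem P (stacks st) c <-> exists2 st', Q st' & c = stacks st'.

Lemma spec_ext P st Q Q' :
  (forall st', Q st' <-> Q' st') -> spec P st Q -> spec P st Q'.
Proof.
move=> QQ' PQ c; apply: (iff_trans (PQ c)).
by split=> -[st' Qst' ->]; exists st' => //; apply/QQ'.
Qed.

Lemma spec_bind P P' st Q Q' :
  spec P st Q -> (forall st', Q st' -> spec P' st' (Q' st')) ->
  spec (Seq P P') st (fun st2 => exists2 st1, Q st1 & Q' st1 st2).
Proof.
move=> PQ PQ' c /=; split.
  case=> d /PQ [st1 Q1 ->] /(PQ' _ Q1) [st2 Q2 ->].
  by exists st2 => //; exists st1.
case=> st2 [st1 Q1 Q2] ->; exists (stacks st1); first by apply/PQ; exists st1.
by apply/(PQ' _ Q1); exists st2.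
Qed.

Lemma spec_seq P P' st st1 Q :
  spec P st (eq st1) -> spec P' st1 Q -> spec (Seq P P') st Q.
Proof.
move=> P1 PQ.
apply: (spec_ext (Q := fun st' => exists2 st2, st1 = st2 & Q st')).
  by move=> st'; split=> [[_ _ //]|Qst']; exists st1.
by apply: (spec_bind (Q' := fun _ => Q) P1) => _ <-.
Qed.

Definition fails (st : state) : Prop := False.

Lemma spec_seq_fails P P' st : spec P st fails -> spec (Seq P P') st fails.
Proof.
move=> F c /=; split; first by case=> d /F [].
by case.
Qed.

(** A loop is unrolled together with its continuation [X], because only [X] decides whether leaving
    now was right. *)
Lemma star_seqE P X c d :
  sem (Seq (Star P) X) c d <->
  sem X c d \/ exists2 e, sem P c e & sem (Seq (Star P) X) e d.
Proof.
split=> /=.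
  case=> e [|c1 e1 cc1 ce1] Xd; first by left.
  by right; exists c1 => //; exists e1.
case=> [Xd|[e ce [f ef Xf]]]; first by exists c => //; apply: rt1n_refl.
by exists f => //; apply: Relation_Operators.rt1n_trans ef.
Qed.

Lemma spec_loop_exit P X st Q :
  spec P st fails -> spec X st Q -> spec (Seq (Star P) X) st Q.
Proof.
move=> F XQ c; apply: (iff_trans (star_seqE _ _ _ _)); split.
  by case=> [/XQ //|[e /F []]].
by move/XQ; left.
Qed.

Lemma spec_loop_step P X st st' Q :
  spec P st (eq st') -> spec X st fails -> spec (Seq (Star P) X) st' Q ->
  spec (Seq (Star P) X) st Q.
Proof.
move=> S F PQ c; apply: (iff_trans (star_seqE _ _ _ _)); split.
  by case=> [/F []//|[e /S [_ <- ->] /PQ]].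
by move/PQ=> XQ; right; exists (stacks st') => //; apply/S; exists st'.
Qed.

(** For loops whose body is known only through a relation. Preservation makes [S] contain all states
    at the loop head; the last hypothesis makes every state of [S] one of them. The closure grows at
    its end, as an induction on a loop counter does. *)
Lemma spec_star P st (S : state -> Prop) (R : state -> state -> Prop) :
  S st -> (forall b, S b -> spec P b (R b)) ->
  (forall b b', S b -> R b b' -> S b') ->
  (forall b, S b -> clos_refl_trans_n1 _ R st b) ->
  spec (Star P) st S.
Proof.
move=> Sst PR SR reach c; split=> /=.
  suff gen c0 : clos_refl_trans_1n _ (sem P) c0 c ->
      forall b, S b -> c0 = stacks b -> exists2 st', S st' & c = stacks st'.
    by move=> sc; apply: gen sc _ Sst _.
  elim=> [c1|c1 c2 c3 c12 _ IH] b Sb e; first by exists b.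
  move: c12; rewrite e => /(PR _ Sb) [b' Rb' c2b'].
  by apply: (IH b') => //; apply: SR Rb'.
case=> b Sb ->; apply: clos_rt_rt1n.
elim: {Sb}(reach _ Sb) => [|b1 b2 R12 st1 IH]; first exact: rt_refl.
apply: rt_trans IH _; apply: rt_step; apply/(PR b1); last by exists b2.
(* [b1] lies in [S], being reached from [st] by steps that preserve [S]. *)
by elim: st1 => // b3 b4 R34 _ S3; apply: SR R34.
Qed.

(* Pushing [true] on the empty stack succeeds but leaves the image of [blocks];
   [op1] returns a junk [None] there, and [growable] excludes the case. *)
Definition op1 (i : stack_id) (a : letter) (l : seq nat) : option (seq nat) :=
  if a is Some (j, pushing, b) then
    if j == i then
      match pushing, b, l with
      | true, false, _ => Some (0 :: l)
      | true, true, x :: l' => Some (x.+1 :: l')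
      | false, true, x.+1 :: l' => Some (x :: l')
      | false, false, 0 :: l' => Some l'
      | _, _, _ => None
      end
    else Some l
  else Some l.

Definition growable (i : stack_id) (a : letter) (l : seq nat) : bool :=
  (a == push i true) ==> (l != [::]).

Lemma act1_blocks i a l :
  growable i a l -> act1 i a (blocks l) = omap blocks (op1 i a l).
Proof.
rewrite /growable; case: a => [[[j p] b]|] //=.
have [->|//] := eqVneq j i; case: p b l => [] [] [|[|x] l] //=.
by rewrite eqxx.
Qed.

Definition op (a : letter) (st : state) : option state :=
  let: (l, m, n) := st in
  match op1 i0 a l, op1 i1 a m, op1 i2 a n with
  | Some l', Some m', Some n' => Some (l', m', n')
  | _, _, _ => None
  end.

Definition ready (a : letter) (st : state) : bool :=
  let: (l, m, n) := st in
  [&& growable i0 a l, growable i1 a m & growable i2 a n].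

Lemma act_stacks a st :
  ready a st -> act a (stacks st) = omap stacks (op a st).
Proof.
case: st => [[l m] n] /and3P[gl gm gn]; rewrite /= !act1_blocks //.
by case: op1 => //= ?; case: op1 => //= ?; case: op1.
Qed.

Lemma spec_op a st st' :
  ready a st -> op a st = Some st' -> spec (Op a) st (eq st').
Proof.
move=> ra oa c; rewrite /= act_stacks // oa /=.
by split=> [[<-]|[_ <- ->]] //; exists st'.
Qed.

Lemma spec_op_fails a st :
  ready a st -> op a st = None -> spec (Op a) st fails.
Proof. by move=> ra oa c; rewrite /= act_stacks // oa /=; split=> [|[]]. Qed.

Ltac run_ops :=
  repeat first [ apply: spec_op; [by [] | reflexivity]
    | apply: spec_op_fails; [by [] | reflexivity]
    | apply: spec_seq; [apply: spec_op; [by [] | reflexivity] |]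
    | apply: spec_seq_fails; apply: spec_op_fails; [by [] | reflexivity]].

(** * Moving, copying and comparing blocks *)

Definition move_block (i j : stack_id) : prog :=
  Seq (Op (push j false))
    (Seq (Star (Seq (Op (pop i true)) (Op (push j true)))) (Op (pop i false))).

Lemma spec_move01 x l m n :
  spec (move_block i0 i1) (x :: l, m, n) (eq (l, x :: m, n)).
Proof.
(* The fresh block [0] is generalized to an accumulator [y]: the sum of the two blocks is constant,
   and for each [x] exactly one of exit and body succeeds. *)
run_ops; rewrite -{2}[x]addn0; elim: x 0 => [|x IH] y.
  by apply: spec_loop_exit; run_ops.
by rewrite addSnnS; apply: (spec_loop_step _ _ (IH _)); run_ops.
Qed.

Lemma spec_move10 x l m n :
  spec (move_block i1 i0) (l, x :: m, n) (eq (x :: l, m, n)).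
Proof.
run_ops; rewrite -{2}[x]addn0; elim: x 0 => [|x IH] y.
  by apply: spec_loop_exit; run_ops.
by rewrite addSnnS; apply: (spec_loop_step _ _ (IH _)); run_ops.
Qed.

Lemma spec_move20 x l m n :
  spec (move_block i2 i0) (l, m, x :: n) (eq (x :: l, m, n)).
Proof.
run_ops; rewrite -{2}[x]addn0; elim: x 0 => [|x IH] y.
  by apply: spec_loop_exit; run_ops.
by rewrite addSnnS; apply: (spec_loop_step _ _ (IH _)); run_ops.
Qed.

(** Reading a block destroys it, so two copies are made and one is moved back; this is what the
    third stack is for. *)
Definition copy_top : prog :=
  Seq (Seq (Op (push i1 false)) (Seq (Op (push i2 false))
    (Seq (Star (Seq (Op (pop i0 true))
                 (Seq (Op (push i1 true)) (Op (push i2 true)))))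
      (Op (pop i0 false))))) (move_block i1 i0).

Lemma spec_copy_top x l m n :
  spec copy_top (x :: l, m, n) (eq (x :: l, m, x :: n)).
Proof.
apply: (@spec_seq _ _ _ (l, x :: m, x :: n)); last exact: spec_move10.
run_ops; rewrite -{2 3}[x]addn0; elim: x 0 => [|x IH] y.
  by apply: spec_loop_exit; run_ops.
by rewrite addSnnS; apply: (spec_loop_step _ _ (IH _)); run_ops.
Qed.

(** The blocks above the wanted one wait on [i1], while the copy stays on [i2], out of their way. *)
Fixpoint copy_nth (d : nat) : prog :=
  if d is d'.+1 then
    Seq (move_block i0 i1) (Seq (copy_nth d') (move_block i1 i0))
  else copy_top.

Lemma spec_copy_nth d l m n :
  d < size l -> spec (copy_nth d) (l, m, n) (eq (l, m, nth 0 l d :: n)).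
Proof.
elim: d l m => [|d IH] [|x l] m //= dl; first exact: spec_copy_top.
apply: (spec_seq (spec_move01 _ _ _ _)).
exact: (spec_seq (IH _ _ dl) (spec_move10 _ _ _ _)).
Qed.

Definition push_nth (d : nat) : prog := Seq (copy_nth d) (move_block i2 i0).

Lemma spec_push_nth d l m n :
  d < size l -> spec (push_nth d) (l, m, n) (eq (nth 0 l d :: l, m, n)).
Proof.
by move=> dl; apply: spec_seq (spec_copy_nth _ _ dl) (spec_move20 _ _ _ _).
Qed.

Definition drop_top : prog :=
  Seq (Star (Op (pop i0 true))) (Op (pop i0 false)).

Lemma spec_drop_top x l m n : spec drop_top (x :: l, m, n) (eq (l, m, n)).
Proof.
elim: x => [|x IH]; first by apply: spec_loop_exit; run_ops.
by apply: (spec_loop_step _ _ IH); run_ops.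
Qed.

Definition nip : prog :=
  Seq (move_block i0 i1) (Seq drop_top (move_block i1 i0)).

Lemma spec_nip x y l m n : spec nip (x :: y :: l, m, n) (eq (x :: l, m, n)).
Proof.
apply: (spec_seq (spec_move01 _ _ _ _)).
exact: (spec_seq (spec_drop_top _ _ _ _) (spec_move10 _ _ _ _)).
Qed.

(** A filter, not a branch: both blocks are decremented together, and only runs in which both reach
    0 at once survive. *)
Definition test_eq : prog :=
  Seq (move_block i0 i1)
    (Seq (Star (Seq (Op (pop i0 true)) (Op (pop i1 true))))
      (Seq (Op (pop i0 false)) (Op (pop i1 false)))).

Lemma spec_test_eq x y l m n :
  spec test_eq (x :: y :: l, m, n) (fun st => x = y /\ st = (l, m, n)).
Proof.
apply: (spec_seq (spec_move01 _ _ _ _)).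
elim: y x => [|y IH] [|x].
- apply: (spec_ext (Q := eq (l, m, n))).
    by move=> st; split=> [<-|[_ ->]].
  by apply: spec_loop_exit; run_ops.
- apply: (spec_ext (Q := fails)); first by move=> st; split=> [|[]].
  by apply: spec_loop_exit; run_ops.
- apply: (spec_ext (Q := fails)); first by move=> st; split=> [|[]].
  by apply: spec_loop_exit; run_ops.
- apply: spec_ext (spec_loop_step _ _ (IH x)); [|by run_ops|by run_ops].
  by move=> st; split=> -[]; [move=> -> ->|case=> -> ->].
Qed.

Definition args (n : nat) (ps : n.-tuple nat) (xs : seq nat) : n.-tuple nat :=
  map_tuple (nth 0 xs) ps.

Definition in_range (ps xs : seq nat) : bool := all (fun p => p < size xs) ps.

(* The arguments are not popped: the [i]-th one is read at depth [tnth ps i], so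
   that they may lie below intermediate results. *)
Definition computes n (P : prog) (ps : n.-tuple nat)
    (F : n.-tuple nat -> nat -> Prop) : Prop :=
  forall xs, in_range ps xs ->
    spec P (xs, [::], [::])
      (fun st => exists2 y, F (args ps xs) y & st = (y :: xs, [::], [::])).

(** * Stack programs for recursive functions *)

Lemma in_range_mem ps xs p : in_range ps xs -> p \in ps -> p < size xs.
Proof. by move/allP; apply. Qed.

Lemma spec_call n P (ps : n.-tuple nat) F P' xs Q :
  computes P ps F -> in_range ps xs ->
  (forall y, F (args ps xs) y -> spec P' (y :: xs, [::], [::]) (Q y)) ->
  spec (Seq P P') (xs, [::], [::])
    (fun st => exists2 y, F (args ps xs) y & Q y st).
Proof.
move=> cP ok PQ c; split=> /=.
  case=> d /(cP _ ok) [_ [y Fy ->] ->] /(PQ _ Fy) [st Qst ->].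
  by exists st => //; exists y.
case=> st [y Fy Qst] ->; exists (stacks (y :: xs, [::], [::])).
  by apply/(cP _ ok); exists (y :: xs, [::], [::]) => //; exists y.
by apply/(PQ _ Fy); exists st.
Qed.

Lemma in_range_shift ps xs ys :
  in_range ps xs -> in_range [seq size ys + p | p <- ps] (ys ++ xs).
Proof.
move=> ok; rewrite /in_range all_map; apply: sub_all ok => p /=.
by rewrite size_cat ltn_add2l.
Qed.

Lemma map_nth_shift ps xs ys :
  [seq nth 0 (ys ++ xs) i | i <- [seq size ys + p | p <- ps]] =
  [seq nth 0 xs p | p <- ps].
Proof.
rewrite -map_comp; apply: eq_map => p /=.
by rewrite nth_cat ltnNge leq_addr /= addKn.
Qed.

Definition programmable n (f : recfun n) : Prop :=
  forall ps, exists P, computes P ps (eval f).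

Lemma programmable_zero n : programmable (Zero n).
Proof.
move=> ps; exists (Op (push i0 false)) => xs _.
apply: (spec_ext (Q := eq (0 :: xs, [::], [::]))); last by run_ops.
by move=> st; split=> [<-|[_ -> ->]] //; exists 0.
Qed.

Lemma programmable_succ : programmable Succ.
Proof.
move=> ps; exists (Seq (push_nth (thead ps)) (Op (push i0 true))) => xs ok.
have px : thead ps < size xs by apply: in_range_mem ok (mem_tnth _ _).
apply: (spec_ext (Q := eq ((nth 0 xs (thead ps)).+1 :: xs, [::], [::]))).
  have -> : nth 0 xs (thead ps) = thead (args ps xs) by rewrite /thead tnth_map.
  by move=> st; split=> [<-|[_ -> ->]] //; eexists; first by [].
by apply: spec_seq (spec_push_nth _ _ px) _; run_ops.
Qed.

Lemma programmable_proj n (i : 'I_n) : programmable (Proj i).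
Proof.
move=> ps; exists (push_nth (tnth ps i)) => xs ok.
have px : tnth ps i < size xs by apply: in_range_mem ok (mem_tnth _ _).
apply: spec_ext (spec_push_nth _ _ px) => st /=.
rewrite -(tnth_map (nth 0 xs)).
by split=> [<-|[_ -> ->]] //; eexists; first by [].
Qed.

Fixpoint nips (k : nat) : prog :=
  if k is k'.+1 then Seq nip (nips k') else Op None.

Lemma spec_nips x ys l m n :
  spec (nips (size ys)) (x :: ys ++ l, m, n) (eq (x :: l, m, n)).
Proof.
elim: ys => [|y ys IH] /=; first by run_ops.
exact: spec_seq (spec_nip _ _ _ _ _) IH.
Qed.

(** The functions are evaluated from the last to the first, each with its argument positions shifted
    past the results already pushed; the results then lie in order on top of the stack. *)
Lemma programmable_comp k n (g : recfun k) (h : 'I_k -> recfun n) :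
  programmable g -> (forall i, programmable (h i)) -> programmable (Comp g h).
Proof.
move=> pg ph ps.
(* [ys] holds the results of the last [size ys] functions, hence the offset [k - size ys]. *)
pose results xs ys := forall i : 'I_k,
  k - size ys <= i -> eval (h i) (args ps xs) (nth 0 ys (i - (k - size ys))).
have [P specP] : exists P, forall xs, in_range ps xs ->
    spec P (xs, [::], [::]) (fun st => exists ys : k.-tuple nat,
      (forall i, eval (h i) (args ps xs) (tnth ys i)) /\
      st = (ys ++ xs, [::], [::])).
  have [P specP] : exists P, forall xs, in_range ps xs ->
      spec P (xs, [::], [::]) (fun st => exists ys,
        [/\ size ys = k, results xs ys & st = (ys ++ xs, [::], [::])]).
    suff : forall j, j <= k -> exists P, forall xs, in_range ps xs ->
        spec P (xs, [::], [::]) (fun st => exists ys,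
          [/\ size ys = j, results xs ys & st = (ys ++ xs, [::], [::])]).
      by apply.
    elim=> [_|j IH lt_jk].
      exists (Op None) => xs _.
      apply: (spec_ext (Q := eq (xs, [::], [::]))); last by run_ops.
      move=> st; split=> [<-|[[|? ?] [] // _ _ ->]] //; exists [::]; split=> //.
      by move=> i; rewrite subn0 leqNgt ltn_ord.
    have [P specP] := IH (ltnW lt_jk).
    have lt_i : k - j.+1 < k by rewrite -subSn // subSS leq_subr.
    pose i := Ordinal lt_i.
    have [Q cQ] := ph i [tuple of [seq j + p | p <- ps]].
    exists (Seq P Q) => xs ok.
    apply: spec_ext (spec_bind (specP _ ok) (Q' := fun st st' =>
      exists2 y, eval (h i) (args ps xs) y
               & st' = (y :: st.1.1, [::], [::])) _); last first.
      move=> _ [ys [sz _ ->]] /=.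
      have ok' : in_range [tuple of [seq j + p | p <- ps]] (ys ++ xs).
        by rewrite -sz; apply: in_range_shift.
      apply: spec_ext (cQ _ ok') => st.
      suff -> : args [tuple of [seq j + p | p <- ps]] (ys ++ xs)
              = args ps xs by [].
      by apply: val_inj; rewrite /= -sz map_nth_shift.
    have step l : (k - j.+1 <= l) = (l == k - j.+1) || (k - j <= l).
      by rewrite leq_eqVlt eq_sym -subSn // subSS.
    move=> st; split.
      case=> _ [ys [sz rys ->]] [y hy ->]; exists (y :: ys); split=> //=.
        by rewrite sz.
      move=> l; rewrite /= sz step => /orP[/eqP el|le_l].
        by rewrite el subnn; have -> : l = i by apply: val_inj.
      have -> : l - (k - j.+1) = (l - (k - j)).+1.
        by rewrite -(subnSK lt_jk) subnSK // subnSK.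
      by have := rys l; rewrite sz => /(_ le_l).
    case=> -[|y ys] [] //= [sz] rys ->; exists (ys ++ xs, [::], [::]).
      exists ys; split=> // l; rewrite sz => le_l.
      have := rys l; rewrite /= sz step le_l orbT => /(_ isT).
      have -> // : l - (k - j.+1) = (l - (k - j)).+1.
      by rewrite -(subnSK lt_jk) subnSK // subnSK.
    exists y => //=; have := rys i; rewrite /= sz leqnn => /(_ isT).
    by rewrite subnn.
  exists P => xs ok; apply: spec_ext (specP _ ok) => st; split.
    case=> ys [/eqP sz rys ->]; exists (Tuple sz); split=> // i.
    by have := rys i; rewrite (eqP sz) subnn subn0 (tnth_nth 0); apply.
  case=> ys [rys ->]; exists ys; rewrite size_tuple; split=> // i _.
  by rewrite size_tuple subnn subn0 -tnth_nth.
(* The results lie at depths [0] to [k - 1]; [nips k] later removes them from under the value of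
   [g]. *)
have [Q cQ] := pg [tuple of iota 0 k].
exists (Seq P (Seq Q (nips k))) => xs ok.
apply: spec_ext (spec_bind (specP _ ok) (Q' := fun st st' =>
   exists2 y, eval g (args [tuple of iota 0 k] st.1.1) y
            & (y :: xs, [::], [::]) = st') _); last first.
  move=> _ [ys [_ ->]]; apply: (spec_call cQ) => [|y gy].
    apply/allP=> p; rewrite mem_iota /= => lt_pk.
    by rewrite size_cat size_tuple ltn_addr.
  by have := spec_nips y ys xs [::] [::]; rewrite size_tuple.
have argsE (ys : k.-tuple nat) : args [tuple of iota 0 k] (ys ++ xs) = ys.
  apply: val_inj => /=; transitivity [seq nth 0 ys i | i <- iota 0 k].
    by apply/eq_in_map=> p; rewrite mem_iota /= nth_cat size_tuple => ->.
  by rewrite map_nth_iota0 ?size_tuple // take_oversize ?size_tuple.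
move=> st; split.
  case=> _ [ys [hys ->]] [y]; rewrite argsE => gy <-.
  by exists y => //; exists ys.
case=> y [ys hys gy] ->; exists (ys ++ xs, [::], [::]); first by exists ys.
by exists y; rewrite ?argsE.
Qed.

(** Separates the value of the base from the loop, which can then be analysed for a fixed start
    [z0]. *)
Lemma prim_iter_base n (g : n.-tuple nat -> nat -> Prop) h xs m z :
  prim_iter g h xs m z <->
  exists2 z0, g xs z0 & prim_iter (fun _ => eq z0) h xs m z.
Proof.
elim: m z => [|m IH] z /=; first by split=> [gz|[z0 gz <-] //]; exists z.
split=> [[z' /IH[z0 gz0 pz'] hz]|[z0 gz0 [z' pz' hz]]].
  by exists z0 => //; exists z'.
by exists z' => //; apply/IH; exists z0.
Qed.

Lemma spec_seq_cond P P' st (C : Prop) st1 Q :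
  spec P st (fun st' => C /\ st' = st1) -> spec P' st1 Q ->
  spec (Seq P P') st (fun st' => C /\ Q st').
Proof.
move=> PC PQ.
apply: (spec_ext (Q := fun st' => exists2 st2, C /\ st2 = st1 & Q st')).
  by move=> st'; split=> [[_ [HC _] HQ]|[HC HQ]] //; exists st1.
by apply: (spec_bind (Q' := fun _ => Q) PC) => _ [_ ->].
Qed.

(** The number of rounds is guessed: the loop keeps the current value [z] above a counter [i], and
    the test after it lets only [i = m] through. *)
Lemma programmable_primrec n (g : recfun n) (h : recfun n.+2) :
  programmable g -> programmable h -> programmable (PrimRec g h).
Proof.
move=> pg ph ps.
have [P cP] := pg [tuple of [seq 1 + p | p <- behead ps]].
(* On [z :: i :: xs] the counter has depth 1, the value depth 0, and the parameters lie 2 deeper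
   than in [xs]. *)
have [Q cQ] := ph [tuple of 1 :: 0 :: [seq 2 + p | p <- behead ps]].
pose body := Seq Q (Seq nip (Seq (move_block i0 i1)
  (Seq (Op (push i0 true)) (move_block i1 i0)))).
(* When the recursion argument is fetched, a copy of [i], then [z] and [i], lie above [xs]; hence
   the 3. *)
pose test := Seq (push_nth 1) (Seq (push_nth (3 + thead ps)) (Seq test_eq nip)).
exists (Seq (Op (push i0 false)) (Seq P (Seq (Star body) test))) => xs ok.
have okp : thead ps < size xs by apply: in_range_mem ok (mem_tnth _ _).
have okb : in_range (behead ps) xs.
  by apply/allP=> p /mem_behead; apply: in_range_mem ok.
set m := thead (args ps xs); set params := behead_tuple (args ps xs).
have argsP i : args [tuple of [seq 1 + p | p <- behead ps]] (i :: xs) = params.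
  by apply: val_inj; rewrite /= (map_nth_shift _ _ [:: i]) behead_map.
have argsQ i z : args [tuple of 1 :: 0 :: [seq 2 + p | p <- behead ps]]
    (z :: i :: xs) = [tuple of i :: z :: params].
  apply: val_inj; rewrite /= (map_nth_shift _ _ [:: z; i]).
  by rewrite behead_map.
have bodyP i z : spec body (z :: i :: xs, [::], [::]) (fun st =>
    exists2 z', eval h [tuple of i :: z :: params] z'
              & (z' :: i.+1 :: xs, [::], [::]) = st).
  rewrite -argsQ; apply: (spec_call cQ) => [|z' _].
    exact: (in_range_shift [:: z; i] okb).
  apply: (spec_seq (spec_nip _ _ _ _ _)).
  apply: (spec_seq (spec_move01 _ _ _ _)).
  by apply: spec_seq; last exact: spec_move10; run_ops.
have testP i z : spec test (z :: i :: xs, [::], [::])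
    (fun st => m = i /\ (z :: xs, [::], [::]) = st).
  apply: spec_seq; first exact: spec_push_nth.
  apply: spec_seq; first by apply: spec_push_nth; rewrite /= !ltnS.
  rewrite /= -(tnth_map (nth 0 xs)).
  exact: spec_seq_cond (spec_test_eq _ _ _ _ _) (spec_nip _ _ _ _ _).
have loopP z0 : spec (Seq (Star body) test) (z0 :: 0 :: xs, [::], [::])
    (fun st =>
    exists2 z, prim_iter (fun _ => eq z0) (eval h) params m z
             & st = (z :: xs, [::], [::])).
  pose F := prim_iter (fun _ => eq z0) (eval h) params.
  pose S st := exists i z, F i z /\ st = (z :: i :: xs, [::], [::]) :> state.
  apply: (@spec_ext _ _ (fun st => exists2 st', S st' &
     m = nth 0 st'.1.1 1 /\ (head 0 st'.1.1 :: xs, [::], [::]) = st)).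
    move=> st; split=> [[_ [i [z [Fz ->]]] /= [mi <-]]|[z Fz ->]].
      by exists z; rewrite // mi.
    by exists (z :: m :: xs, [::], [::]) => //; exists m, z.
  apply: (@spec_bind _ _ _ S (fun st' st =>
    m = nth 0 st'.1.1 1 /\ (head 0 st'.1.1 :: xs, [::], [::]) = st)); last first.
    by move=> _ [i [z [_ ->]]]; apply: testP.
  apply: (@spec_star _ _ _ (fun st st' => exists2 z',
    eval h [tuple of nth 0 st.1.1 1 :: head 0 st.1.1 :: params] z'
    & (z' :: (nth 0 st.1.1 1).+1 :: xs, [::], [::]) = st')).
  - by exists 0, z0.
  - by move=> _ [i [z [_ ->]]]; apply: bodyP.
  - move=> _ _ [i [z [Fz ->]]] /= [z' hz' <-].
    by exists i.+1, z'; split=> //; exists z.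
  - move=> _ [i [z [Fz ->]]]; elim: i z Fz => [_ <-|i IH z [z' /IH reach hz]].
      exact: Relation_Operators.rtn1_refl.
    by apply: Relation_Operators.rtn1_trans reach; exists z.
apply: spec_seq; first by run_ops.
apply: spec_ext (spec_call cP (in_range_shift [:: 0] okb) (fun z _ => loopP z)).
move=> st; rewrite argsP; split.
  case=> z0 gz0 [z Fz ->]; exists z => //.
  by rewrite eval_PrimRec; apply/prim_iter_base; exists z0.
case=> y; rewrite eval_PrimRec => /prim_iter_base[z0 gz0 Fy] ->.
by exists z0 => //; exists y.
Qed.

(** [g] is evaluated at the candidate both in the loop and after it: the loop passes to the next
    candidate only on a positive value, and the exit accepts only the value 0. *)
Lemma programmable_mu n (g : recfun n.+1) :
  programmable g -> programmable (Mu g).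
Proof.
move=> pg ps.
have [P cP] := pg [tuple of 0 :: [seq 1 + p | p <- ps]].
(* Popping [true] tests that the value is positive; once the rest of the value is dropped, the push
   increments the candidate. *)
pose body := Seq P (Seq (Op (pop i0 true)) (Seq drop_top (Op (push i0 true)))).
pose test := Seq P (Op (pop i0 false)).
exists (Seq (Op (push i0 false)) (Seq (Star body) test)) => xs ok.
have argsP i : args [tuple of 0 :: [seq 1 + p | p <- ps]] (i :: xs)
    = [tuple of i :: args ps xs].
  by apply: val_inj; rewrite /= (map_nth_shift _ _ [:: i]).
have okP i : in_range [tuple of 0 :: [seq 1 + p | p <- ps]] (i :: xs).
  exact: (in_range_shift [:: i] ok).
have bodyP i : spec body (i :: xs, [::], [::]) (fun st =>
    exists2 v, eval g [tuple of i :: args ps xs] v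
             & 0 < v /\ (i.+1 :: xs, [::], [::]) = st).
  rewrite -argsP; apply: (spec_call cP) => [//|[|v] _].
    apply: (spec_ext (Q := fails)); first by move=> st; split=> [|[]].
    by run_ops.
  apply: (spec_ext (Q := eq (i.+1 :: xs, [::], [::]))).
    by move=> st; split=> [|[]].
  apply: spec_seq; first by run_ops.
  by apply: (spec_seq (spec_drop_top _ _ _ _)); run_ops.
have testP i : spec test (i :: xs, [::], [::]) (fun st =>
    exists2 v, eval g [tuple of i :: args ps xs] v
             & v = 0 /\ (i :: xs, [::], [::]) = st).
  rewrite -argsP; apply: (spec_call cP) => [//|[|v] _].
    apply: (spec_ext (Q := eq (i :: xs, [::], [::]))); last by run_ops.
    by move=> st; split=> [|[]].
  by apply: (spec_ext (Q := fails)); [move=> st; split=> [|[]] | run_ops].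
apply: spec_seq; first by run_ops.
pose S st := exists i, (forall j, j < i -> exists v,
  eval g [tuple of j :: args ps xs] v.+1) /\ st = (i :: xs, [::], [::]) :> state.
apply: (@spec_ext _ _ (fun st => exists2 st', S st' & exists2 v,
    eval g [tuple of head 0 st'.1.1 :: args ps xs] v
    & v = 0 /\ (head 0 st'.1.1 :: xs, [::], [::]) = st)).
  move=> st; split.
    case=> _ [i [lt_i ->]] /= [v gv [v0 <-]].
    by exists i => //; rewrite v0 in gv.
  case=> y [gy lt_y] ->; exists (y :: xs, [::], [::]); first by exists y.
  by exists 0.
apply: (@spec_bind _ _ _ S (fun st' st => exists2 v,
    eval g [tuple of head 0 st'.1.1 :: args ps xs] v
    & v = 0 /\ (head 0 st'.1.1 :: xs, [::], [::]) = st)); last first.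
  by move=> _ [i [_ ->]]; apply: testP.
apply: (@spec_star _ _ _ (fun st st' => exists2 v,
    eval g [tuple of head 0 st.1.1 :: args ps xs] v
    & 0 < v /\ ((head 0 st.1.1).+1 :: xs, [::], [::]) = st')).
- by exists 0.
- by move=> _ [i [_ ->]]; apply: bodyP.
- move=> _ _ [i [lt_i ->]] /= [[|v] gv [// _ <-]]; exists i.+1; split=> // j.
  by rewrite ltnS leq_eqVlt => /orP[/eqP ->|/lt_i //]; exists v.
- move=> _ [i [lt_i ->]]; elim: i lt_i => [|i IH] lt_i.
    exact: Relation_Operators.rtn1_refl.
  have [v gv] := lt_i i (ltnSn i).
  apply: (Relation_Operators.rtn1_trans _ _ _ (i :: xs, [::], [::])).
    by exists v.+1.
  by apply: IH => j lt_ji; apply: lt_i; apply: ltnW.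
Qed.

Lemma recfun_programmable n (f : recfun n) : programmable f.
Proof.
elim: f => {n} [n|||k n g IHg h IHh|n g IHg h IHh|n g IHg].
- exact: programmable_zero.
- exact: programmable_succ.
- exact: programmable_proj.
- exact: programmable_comp.
- exact: programmable_primrec.
- exact: programmable_mu.
Qed.

(** * From programs to automata *)

Definition transition : Type := (nat * letter * nat)%type.

Inductive reach (T : seq transition) : nat -> config -> nat -> config -> Prop :=
| ReachRefl p c : reach T p c p c
| ReachStep p a q c d r e :
    (p, a, q) \in T -> act a c = Some d -> reach T q d r e -> reach T p c r e.

Lemma reach_inv T p c r e :
  reach T p c r e ->
  (p = r /\ c = e) \/
  exists a q d, [/\ (p, a, q) \in T, act a c = Some d & reach T q d r e].
Proof.
case=> [{}p {}c|{}p a q {}c d {}r {}e pq cd de]; first by left.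
by right; exists a, q, d.
Qed.

Lemma reach_trans T p c q d r e :
  reach T p c q d -> reach T q d r e -> reach T p c r e.
Proof.
elim=> // {p c q d} p a q c d q' d' pq cd _ IH /IH.
exact: ReachStep cd.
Qed.

Lemma reach1 T p a q c d :
  (p, a, q) \in T -> act a c = Some d -> reach T p c q d.
Proof. by move=> pq cd; apply: ReachStep cd (ReachRefl _ _ _). Qed.

Lemma sub_reach T T' p c q d :
  {subset T <= T'} -> reach T p c q d -> reach T' p c q d.
Proof.
move=> sub; elim=> [|{p c q d} p a q c d r e pq cd _]; first exact: ReachRefl.
exact: ReachStep (sub _ pq) cd.
Qed.

Fixpoint exec (w : seq letter) (c : config) : option config :=
  if w is a :: w' then obind (exec w') (act a c) else Some c.

Lemma reachP (A : automaton letter) p c q d :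
  reach (transitions A) p c q d <->
  exists2 w, run A p w q & exec w c = Some d.
Proof.
split=> [|[w]].
  elim=> [|{p c q d} p a q c d r e pq cd _ [w qr de]]; first by exists [::].
  by exists (a :: w); rewrite /= ?cd //; exists q.
elim: w p c => [|a w IH] p c /=; first by move=> -> [->]; apply: ReachRefl.
case=> r pr rq; case E: act => [e|] //= we.
exact: ReachStep pr E (IH _ _ rq we).
Qed.

Lemma exec_exec1 w s0 s1 s2 :
  exec w (s0, s1, s2) =
  match exec1 i0 w s0, exec1 i1 w s1, exec1 i2 w s2 with
  | Some t0, Some t1, Some t2 => Some (t0, t1, t2)
  | _, _, _ => None
  end.
Proof.
elim: w s0 s1 s2 => //= a w IH s0 s1 s2.
case: (act1 i0) => //= t0.
case: (act1 i1) => [t1|] /=; last by case: (exec1 i0 w t0).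
case: (act1 i2) => [t2|] /=; first exact: IH.
by case: (exec1 i0 w t0) => // ?; case: (exec1 i1 w t1).
Qed.

Definition within (lo hi : nat) (T : seq transition) : bool :=
  all (fun t => (lo <= t.1.1 <= hi) && (lo <= t.2 <= hi)) T.

Lemma within_mem lo hi T p a q :
  within lo hi T -> (p, a, q) \in T -> lo <= p <= hi /\ lo <= q <= hi.
Proof. by move/allP=> inT /inT /andP[]. Qed.

Lemma withinW lo hi lo' hi' T :
  lo' <= lo -> hi <= hi' -> within lo hi T -> within lo' hi' T.
Proof.
move=> llo lhi; apply: sub_all => t /andP[/andP[l1 h1] /andP[l2 h2]].
by rewrite !(leq_trans llo) // !(leq_trans _ lhi).
Qed.

(** Confining the states to an interval lets pieces with disjoint intervals be joined by idle
    transitions without interfering. *)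
Definition implements (T : seq transition) (lo hi : nat) (P : prog) : Prop :=
  [/\ lo <= hi, within lo hi T
    & forall c d, reach T lo c hi d <-> sem P c d].

Lemma act_none c : act None c = Some c.
Proof. by case: c => -[]. Qed.

Lemma implements_op a lo : implements [:: (lo, a, lo.+1)] lo lo.+1 (Op a).
Proof.
split=> //; first by rewrite /within /= !leqnn !leqnSn.
move=> c d; split=> /= [|cd]; last by apply: reach1 cd; rewrite inE.
case/reach_inv=> [[/n_Sn //]|[b [q [e [+ + /reach_inv]]]]].
rewrite inE => /eqP[-> ->] -> [[_ -> //]|[b' [q' [e' [+ _ _]]]]].
by rewrite inE => /eqP[/esym/n_Sn].
Qed.

Lemma implements_seq T1 T2 lo mi hi P Q :
  implements T1 lo mi P -> implements T2 mi.+1 hi Q ->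
  implements ((mi, None, mi.+1) :: T1 ++ T2) lo hi (Seq P Q).
Proof.
move=> [le1 in1 P1] [le2 in2 P2]; split.
- exact: leq_trans le1 (ltnW le2).
- rewrite /within /= all_cat -!/(within _ _ _).
  rewrite (withinW _ _ in1) ?(ltnW le2) // (withinW _ _ in2) //; last exact: leqW.
  by rewrite ?le1 ?le2 ?(ltnW le2) ?(leqW le1).
move=> c d; split=> [|[e /P1 ce /P2 ed]]; last first.
  apply: reach_trans (sub_reach _ ce) _.
    by move=> t; rewrite in_cons mem_cat => ->; rewrite orbT.
  apply: (@ReachStep _ _ None mi.+1 _ e); first exact: mem_head.
    exact: act_none.
  by apply: sub_reach ed => t; rewrite in_cons mem_cat => ->; rewrite !orbT.
(* The bridge from [mi] to [mi.+1] is the only link between the pieces and leads one way: a run past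
   [mi] stays in [T2], any other run must cross. *)
suff gen p : reach ((mi, None, mi.+1) :: T1 ++ T2) p c hi d ->
    (mi < p -> reach T2 p c hi d) /\
    (lo <= p <= mi -> exists2 e, reach T1 p c mi e & reach T2 mi.+1 e hi d).
  move/gen=> [_ []]; first by rewrite leqnn.
  by move=> e /P1 ce /P2 ed; exists e.
move E: hi => h r; elim: r E => {p c h d} [p c|p a q c d h e pq cd _ IH] ph.
  split=> [_|/andP[_]]; first exact: ReachRefl.
  by rewrite leqNgt -ph le2.
case: (IH ph) => {}ph2 ph1; move: pq; rewrite in_cons mem_cat.
case/or3P=> [/eqP[-> ea eq]|pq|pq].
- split=> [|_]; first by rewrite ltnn.
  exists c; first exact: ReachRefl.
  by move: cd ph2; rewrite ea act_none eq => -[->]; apply.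
- case: (within_mem in1 pq) => /andP[_ lep] inq; split=> [|_].
    by rewrite ltnNge lep.
  by have [f qf fe] := ph1 inq; exists f => //; apply: ReachStep cd qf.
- case: (within_mem in2 pq) => /andP[ltp _] /andP[ltq _]; split=> [_|/andP[_]].
    exact: ReachStep cd (ph2 ltq).
  by rewrite leqNgt ltp.
Qed.

(** [lo] and [hi.+1] are fresh: every round starts and ends at the hub [lo], and nothing leaves the
    exit [hi.+1]. *)
Lemma implements_star T lo hi P :
  implements T lo.+1 hi P ->
  implements [:: (lo, None, lo.+1), (hi, None, lo), (lo, None, hi.+1) & T]
    lo hi.+1 (Star P).
Proof.
move=> [le_lh inT PT]; set U := [:: _, _, _ & T].
have lt_lh : lo < hi.+1 by apply: leqW.
split; first exact: ltnW.
  rewrite /within /= -/(within _ _ _) (withinW _ _ inT) //.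
  by rewrite !leqnn !leqnSn !(ltnW lt_lh) ltnS (ltnW le_lh).
have in1 : (lo, None, lo.+1) \in U by rewrite !in_cons eqxx.
have in2 : (hi, None, lo) \in U by rewrite !in_cons eqxx !orbT.
have in3 : (lo, None, hi.+1) \in U by rewrite !in_cons eqxx !orbT.
have subU : {subset T <= U} by move=> t; rewrite !in_cons => ->; rewrite !orbT.
move=> c d; split=> [|cd]; last first.
  elim: cd => {c d} [c|c e d ce _ IH]; first exact: reach1 in3 (act_none c).
  apply: ReachStep in1 (act_none c) _.
  apply: reach_trans (sub_reach subU (proj2 (PT _ _) ce)) _.
  exact: ReachStep in2 (act_none e) IH.
(* One clause for each place where the run may start: the hub, inside [P], the exit. *)
suff gen p : reach U p c hi.+1 d ->
    [/\ p = lo -> clos_refl_trans_1n _ (sem P) c d,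
        lo < p <= hi -> exists2 e, reach T p c hi e
                                 & clos_refl_trans_1n _ (sem P) e d
      & p = hi.+1 -> c = d].
  by case/gen=> + _ _; apply.
move E: hi.+1 => h r; elim: r E => {p c h d} [p c|p a q c d h e pq cd _ IH] ph.
  by rewrite -ph ltnn andbF; split=> // e; move: lt_lh; rewrite e ltnn.
have [qlo qin qhi] := IH ph; move: pq; rewrite !in_cons.
case/or4P=> [/eqP[-> ea eq]|/eqP[-> ea eq]|/eqP[-> ea eq]|pq].
- move: cd; rewrite ea act_none => -[ecd]; rewrite ecd eq in qin *.
  split=> [_||e1].
  + have [|f /PT df fe] := qin; first by rewrite leqnn.
    by apply: Relation_Operators.rt1n_trans fe; apply: df.
  + by rewrite ltnn.
  + by move: lt_lh; rewrite e1 -ph ltnn.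
- move: cd; rewrite ea act_none => -[ecd]; rewrite ecd.
  split=> [e1|_|/eqP].
  + by move: le_lh; rewrite e1 ltnn.
  + by exists d; [apply: ReachRefl | apply: qlo].
  + by rewrite -ph eqn_leq ltnn andbF.
- move: cd; rewrite ea act_none => -[ecd]; rewrite ecd.
  split=> [_||e1].
  + by rewrite (qhi _) ?eq ?ph //; apply: rt1n_refl.
  + by rewrite ltnn.
  + by move: lt_lh; rewrite e1 -ph ltnn.
- case: (within_mem inT pq) => /andP[ltp lep] inq; split=> [e1|_|e1].
  + by move: ltp; rewrite e1 ltnn.
  + have [f qf fe] := qin inq; exists f => //; exact: ReachStep cd qf.
  + by move: lep; rewrite e1 -ph ltnn.
Qed.

Lemma implementable P lo : exists T hi, implements T lo hi P.
Proof.
elim: P lo => [a|P IHP Q IHQ|P IHP] lo.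
- by exists [:: (lo, a, lo.+1)], lo.+1; apply: implements_op.
- have [T1 [mi PT1]] := IHP lo; have [T2 [hi PT2]] := IHQ mi.+1.
  by do 2!eexists; apply: implements_seq PT1 PT2.
- have [T [hi PT]] := IHP lo.+1.
  by do 2!eexists; apply: implements_star PT.
Qed.

(** * Automata that first load a number, and their codes *)

Definition code_transitions (T : seq transition) : nat :=
  CodeSeq.code [seq @encode_transition letter t | t <- T].

Lemma ltn_code_cons x z : x < code_cons x z /\ z < code_cons x z.
Proof.
rewrite /code_cons; split.
  by apply: leq_trans (ltn_expl x (ltnSn 1)) _; rewrite leq_pmulr.
apply: (@leq_trans z.*2.+1); first by rewrite ltnS -addnn leq_addr.
by rewrite leq_pmull ?expn_gt0.
Qed.

Lemma code_transitions_gt T p a q :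
  (p, a, q) \in T -> p < code_transitions T /\ q < code_transitions T.
Proof.
have lt1 x z := proj1 (ltn_code_cons x z).
have lt2 x z := proj2 (ltn_code_cons x z).
elim: T => //= t T IH; rewrite in_cons; case/predU1P=> [<-|/IH [lp lq]].
  rewrite /code_transitions /= /encode_transition !code_consE.
  split; apply: ltn_trans (lt1 _ _) => /=; first exact: lt1.
  by do 2! apply: ltn_trans (lt2 _ _); apply: lt1.
by split; [apply: ltn_trans lp _ | apply: ltn_trans lq _]; apply: lt2.
Qed.

(** [T] is kept as the tail of the list, so that the code of the whole depends on [T] only through
    the code of [T]. The number is pushed in unary, one state per unit. *)
Fixpoint loader (n k : nat) (T : seq transition) : seq transition :=
  if k is k'.+1 then (n + k'.+1, push i0 true, n + k') :: loader n k' T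
  else (n, None, 1) :: T.

Lemma mem_loader n k T t :
  t \in loader n k T <->
  [\/ t \in T, t = (n, None, 1)
     | exists2 j, j < k & t = (n + j.+1, push i0 true, n + j)].
Proof.
elim: k t => [|k IH] t; rewrite /= in_cons; split.
- by case/predU1P=> [->|tT]; [constructor 2 | constructor].
- by case=> [->|->|[]//]; rewrite ?orbT ?eqxx.
- case/predU1P=> [->|/IH]; first by constructor 3; exists k.
  case=> [tT|->|[j lt_j ->]]; [by constructor|by constructor 2|].
  by constructor 3; exists j => //; apply: leqW.
- case=> [tT|->|[j]]; try by apply/orP; right; apply/IH; constructor.
  rewrite ltnS leq_eqVlt => /predU1P[-> -> |lt_j ->]; first by rewrite eqxx.
  by apply/orP; right; apply/IH; constructor 3; exists j.
Qed.

(* Pushes the number [n] and then enters [T] at state 1. The states of the prefix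
   are numbered from [n] on: with [n := code_transitions T] they are fresh, since
   the code of a list exceeds all numbers occurring in it. *)
Definition loading (T : seq transition) (n : nat) : automaton letter :=
  Automaton [:: (n + n).+1] [:: 0]
    (((n + n).+1, push i0 false, n + n) :: loader n n T).

Lemma loadingP T n d :
  1 < n -> (forall p a q, (p, a, q) \in T -> p < n /\ q < n) ->
  reach (transitions (loading T n)) (n + n).+1 ([::], [::], [::]) 0 d <->
  reach T 1 (stacks ([:: n], [::], [::])) 0 d.
Proof.
move=> n_gt1 Tn; set U := transitions _.
have n_gt0 : 0 < n by apply: ltnW.
have inT p a q : p < n -> (p, a, q) \in U -> (p, a, q) \in T.
  move=> lt_pn; rewrite in_cons; case/predU1P=> [[ep _ _]|].
    by move: lt_pn; rewrite ep ltnNge leqW ?leq_addr.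
  case/mem_loader=> [//|[ep _ _]|[j _ [ep _ _]]]; move: lt_pn; rewrite ep.
    by rewrite ltnn.
  by rewrite ltnNge leq_addr.
have subT : {subset T <= U}.
  move=> t tT; rewrite in_cons; apply/orP; right.
  by apply/mem_loader; constructor.
have fromT p c : p < n -> reach U p c 0 d -> reach T p c 0 d.
  move E: 0 => z + r; elim: r E => {p c z d}.
    by move=> *; apply: ReachRefl.
  move=> p a q c d r e pq cd _ IH r0 lt_pn.
  have pqT := inT _ _ _ lt_pn pq.
  have [_ lt_qn] := Tn _ _ _ pqT.
  exact: ReachStep pqT cd (IH r0 lt_qn).
(* The chain counts down: in state [n + k], there remain [k] units to push on the block [j]. *)
have chain k j : k <= n ->
    reach U (n + k) (stacks ([:: j], [::], [::])) 0 d <->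
    reach T 1 (stacks ([:: j + k], [::], [::])) 0 d.
  elim: k j => [|k IH] j le_kn.
    rewrite !addn0; split=> [|/(sub_reach subT) r]; last first.
      apply: ReachStep r; last exact: act_none.
      by rewrite in_cons; apply/orP; right; apply/mem_loader; constructor 2.
    case/reach_inv=> [[n0]|[a [q [e [+ + r]]]]].
      by move: n_gt0; rewrite n0.
    rewrite in_cons => /predU1P[[/eqP]|].
      by rewrite eqn_leq [_ <= n]ltnNge leq_addr andbF.
    case/mem_loader=> [/Tn[]|[-> eq]|[i _ [/eqP]]]; first by rewrite ltnn.
      by rewrite act_none => -[ce]; move: r; rewrite eq -ce; apply: fromT.
    by rewrite -{1}[n]addn0 eqn_add2l.
  rewrite -[j + _]addSnnS; apply: iff_trans (IH j.+1 (ltnW le_kn)).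
  split; last first.
    apply: (@ReachStep _ _ (push i0 true) (n + k)); last by [].
    rewrite in_cons; apply/orP; right; apply/mem_loader; constructor 3.
    by exists k; rewrite ?addnS.
  case/reach_inv=> [[]|[a [q [e [+ + r]]]]]; first by rewrite addnS.
  rewrite in_cons => /predU1P[[/eqP]|].
    by rewrite -addnS eqn_add2l => /eqP ek; move: le_kn; rewrite ek ltnn.
  case/mem_loader=> [/Tn[]|[/eqP]|[i _ [/eqP + -> eq]]].
  - by rewrite ltnNge leq_addr.
  - by rewrite -{2}[n]addn0 eqn_add2l.
  rewrite eqn_add2l eqSS => /eqP ki [ce].
  by move: r; rewrite eq -ki -ce.
apply: iff_trans (chain n 0 (leqnn n)); split.
  case/reach_inv=> [[]//|[a [q [e [+ + r]]]]]; rewrite in_cons.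
  case/predU1P=> [[-> eq] [ce]|]; first by move: r; rewrite eq -ce.
  case/mem_loader=> [/Tn[]|[/eqP]|[i lt_in [/eqP]]].
  - by rewrite ltnNge leqW ?leq_addr.
  - by rewrite eqn_leq ltnNge leq_addr.
  - by rewrite -addnS eqn_add2l eqSS => /eqP ni; move: lt_in; rewrite -ni ltnn.
by apply: (@ReachStep _ _ (push i0 false) (n + n)); first exact: mem_head.
Qed.

Definition letter_rank (a : letter) : nat := enum_rank a.

Definition transition_code (p l q : nat) : nat :=
  code_cons p (code_cons l (code_cons q 0)).

(** The last [n] of the base case stands for the code of [T]: this is the self-reference. *)
Fixpoint loader_code (k n : nat) : nat :=
  if k is k'.+1 then
    code_cons
      (transition_code (n + k'.+1) (letter_rank (push i0 true)) (n + k'))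
      (loader_code k' n)
  else code_cons (transition_code n (letter_rank None) 1) n.

Definition loading_code (n : nat) : nat :=
  code_cons (code_cons (n + n).+1 0)
    (code_cons (code_cons 0 0)
      (code_cons
        (code_cons
          (transition_code (n + n).+1 (letter_rank (push i0 false)) (n + n))
          (loader_code n n)) 0)).

Lemma encode_loading T :
  encode_automaton (loading T (code_transitions T)) =
  loading_code (code_transitions T).
Proof.
set n := code_transitions T.
have loaderE k : code_transitions (loader n k T) = loader_code k n.
  by elim: k => [|k IH] //; rewrite /= -IH.
by rewrite /loading_code -loaderE.
Qed.

Lemma computable_transition_code n (F G : n.-tuple nat -> nat) l :
  computable F -> computable G ->
  computable (fun xs => transition_code (F xs) l (G xs)).
Proof.
move=> cF cG; apply: computable_cons => //; apply: computable_cons.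
  exact: computable_const.
by apply: computable_cons => //; apply: computable_const.
Qed.

Lemma computable_loader_code :
  computable
    (fun xs : 2.-tuple nat => loader_code (thead xs) (tnth xs ord_max)).
Proof.
apply: (@computable_binary_rec loader_code
  (fun n => code_cons (transition_code n (letter_rank None) 1) n)
  (fun k z n => code_cons
    (transition_code (n + k.+1) (letter_rank (push i0 true)) (n + k)) z)) => //.
  apply: computable_cons; last exact: computable_proj.
  apply: computable_transition_code; first exact: computable_proj.
  exact: computable_const.
apply: computable_cons; last exact: computable_proj.
apply: computable_transition_code;
  apply: computable_add; try exact: computable_proj.
by apply: computable_succ; apply: computable_proj.
Qed.

Lemma computable_loading_code :
  computable (fun xs : 1.-tuple nat => loading_code (thead xs)).
Proof.
have c0 : computable (fun _ : 1.-tuple nat => 0) by apply: computable_const.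
have cn : computable (fun xs : 1.-tuple nat => thead xs).
  exact: computable_proj.
have cnn : computable (fun xs : 1.-tuple nat => thead xs + thead xs).
  exact: computable_add.
have cnn1 := computable_succ cnn.
apply: computable_cons; first exact: computable_cons.
apply: computable_cons; first exact: computable_cons.
apply: computable_cons => //; apply: computable_cons.
  exact: computable_transition_code.
by apply: computable_comp2 => //; apply: computable_loader_code.
Qed.

(** * Diagonalization *)

Definition initial_config : config := ([::], [::], [::]).

(* Kleene's recursion theorem for automata: [T] is a program that computes, from a
   loaded [n], the code of [loading T n] when [n] is the code of [T], and then
   runs [f] on it. *)
Lemma diagonal_automaton (f : recfun 1) : exists A : automaton letter,
  (exists w c, automaton_language A w /\ exec w initial_config = Some c) <->
  eval f [tuple encode_automaton A] 1.
Proof.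
have [s sP] := computable_loading_code.
have [P cP] := recfun_programmable (Comp f (fun _ : 'I_1 => s)) [tuple 0].
(* The two pops succeed only on a block with exactly one [true], that is, on the answer 1. *)
pose D := Seq P (Seq (Op (pop i0 true)) (Op (pop i0 false))).
have DP n : (exists c, sem D (stacks ([:: n], [::], [::])) c) <->
    eval f [tuple loading_code n] 1.
  have accept : spec D ([:: n], [::], [::]) (fun st =>
      exists2 y, eval (Comp f (fun _ : 'I_1 => s)) [tuple n] y
               & y = 1 /\ ([:: n], [::], [::]) = st).
    have -> : [tuple n] = args [tuple 0] [:: n] by apply: val_inj.
    apply: (spec_call cP) => // -[|[|y]] _.
    - by apply: (spec_ext (Q := fails)); [move=> st; split=> [|[]] | run_ops].
    - apply: (spec_ext (Q := eq ([:: n], [::], [::]))); last by run_ops.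
      by move=> st; split=> [|[]].
    - apply: (spec_ext (Q := fails)); first by move=> st; split=> [|[]].
      by apply: spec_seq; [run_ops | run_ops].
  have evalE : eval (Comp f (fun _ : 'I_1 => s)) [tuple n] 1 <->
      eval f [tuple loading_code n] 1.
    split=> [[ys sys fy]|fy] /=.
      suff <- : ys = [tuple loading_code n] by [].
      apply: eq_from_tnth => i; rewrite (eval_functional (sys i) (sP _)).
      by rewrite (tnth_nth 0) (ord1 i).
    exists [tuple loading_code n] => // i; have := sP [tuple n].
    by rewrite (tnth_nth 0) (ord1 i).
  split=> [[c /accept [st [y ey [y1 _]] _]]|/evalE ey].
    by apply/evalE; move: ey; rewrite y1.
  exists (stacks ([:: n], [::], [::])); apply/accept.
  by exists ([:: n], [::], [::]) => //; exists 1.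
(* The states of [D] start at 1, where the loader enters; 0 is kept for the final state. *)
have [T1 [hi [hi_gt0 inT1 T1P]]] := implementable D 1.
pose T := (hi, None, 0) :: T1; pose n := code_transitions T.
have TP c d : reach T 1 c 0 d <-> sem D c d.
  split=> [|/T1P cd]; last first.
    apply: (@reach_trans _ _ _ hi d).
      by apply: sub_reach cd => t; rewrite in_cons orbC => ->.
    by apply: reach1 (act_none d); apply: mem_head.
  suff gen p z : reach T p c z d -> z = 0 ->
      (0 < p <= hi -> reach T1 p c hi d) /\ (p = 0 -> c = d).
    by move/gen/(_ erefl) => [r _]; apply/T1P/r.
  elim=> {p c z d} [p c ->|p a q c d z e pq cd _ IH z0]; first by split.
  have [q1 q2] := IH z0.
  move: pq; rewrite in_cons => /predU1P[[-> ea eq]|pq].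
    split=> [_|hi0]; last by move: hi_gt0; rewrite hi0.
    move: cd; rewrite ea act_none => -[->]; rewrite q2 ?eq //.
    exact: ReachRefl.
  have [/andP[p_gt0 _] inq] := within_mem inT1 pq.
  split=> [_|p0]; first exact: ReachStep pq cd (q1 inq).
  by move: p_gt0; rewrite p0.
have Tn p a q : (p, a, q) \in T -> p < n /\ q < n by exact: code_transitions_gt.
(* The entry state 1 must lie below the fresh states: [hi] is at least 1 and, occurring in [T], is
   less than [n]. *)
have n_gt1 : 1 < n.
  have [lt_hi _] := Tn hi None 0 (mem_head _ _).
  exact: leq_ltn_trans hi_gt0 lt_hi.
exists (loading T n); rewrite encode_loading.
apply: iff_trans (DP n); split=> [[w [c [[p [q [+ + pq]]] wc]]]|[c]].
  rewrite !inE => /eqP ep /eqP eq; exists c; apply/TP/loadingP => //.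
  by apply/reachP; exists w; rewrite -?ep -?eq.
move/TP/(loadingP _ n_gt1 Tn)/(reachP (loading T n))=> [w run_w wc].
exists w, c; split=> //; exists (n + n).+1, 0; split=> //; exact: mem_head.
Qed.

Theorem corollary3p8 :
  exists (Sigma : finType) (L : language Sigma),
    context_free L /\
    ~ decidable_problem (@encode_automaton Sigma)
        (fun A : automaton Sigma => included (automaton_language A) L).
Proof.
exists letter, (cfg_language trace_cfg); split; first by exists trace_cfg.
case=> f fP; have [A haltP] := diagonal_automaton f; have [yes no] := fP A.
have halts_excluded : eval f [tuple encode_automaton A] 1 ->
    ~ included (automaton_language A) (cfg_language trace_cfg).
  move=> /haltP [w [c [Aw +]]] incl; rewrite exec_exec1.
  have /trace_cfgP [[[]|] ->] := incl w Aw.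
  - by case: (exec1 i0 w [::]).
  - by case: (exec1 i0 w [::]) => // ?; case: (exec1 i1 w [::]).
  - by [].
(* Inclusion is refuted without a case distinction: it would make [f] answer 1, hence [A] halt,
   against inclusion. *)
have not_incl : ~ included (automaton_language A) (cfg_language trace_cfg).
  by move=> incl; apply: halts_excluded (yes incl) incl.
(* Now [f] answers 0, hence not 1, so no trace of [A] is feasible and inclusion holds after all. *)
have e0 := no not_incl; apply: not_incl => w Aw; apply/trace_cfgP.
have halts c : exec w initial_config <> Some c.
  move=> wc; suff e1 : eval f [tuple encode_automaton A] 1.
    by have := eval_functional e0 e1.
  by apply/haltP; exists w, c.
move: halts; rewrite exec_exec1.
case E0: (exec1 i0 w [::]) => [t0|]; last by exists i0.
case E1: (exec1 i1 w [::]) => [t1|]; last by exists i1.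
case E2: (exec1 i2 w [::]) => [t2|]; last by exists i2.
by move/(_ (t0, t1, t2)).
Qed.
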